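(* Let $\Sigma$ be an $m$-manifold, $m\ge2$, $n=m+1$, let $E$ be a Legendre filtration of $\Sigma\times\mathbb{R}^{n+1}$, and let $g$ be a metric on $\Sigma\times\mathbb{R}^{n+1}$ enveloped by $E$. Let $\chi^g\in\Omega^1(\Sigma,\underline{\mathfrak g}_{-1}\cap\mathfrak h)$ and $\psi^g\in\Omega^1(\Sigma,\underline{\mathfrak g}_{-2})$, and for $t\in\mathbb{R}$ let $$d^g_t:=\mathcal{D}^g+t\,\mathcal{N}^g+(t^2-1)\chi^g+(t^3-t)\psi^g .$$ Then the connection $d^g_t$ is flat for all $t\in\mathbb{R}$ if and only if $$d^{\mathcal{D}^g}\chi^g=R^{\mathcal{D}^g}\qquad\text{and}\qquad d\psi^g+[\mathcal{N}^g\wedge\chi^g]=0,$$ i.e. if and only if $(E,\chi,\psi)$ is M\''obius-flat.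
   Context: Everything is smooth. $\underline{\mathbb{R}}^{n+1}=\Sigma\times\mathbb{R}^{n+1}$ with trivial connection $d$; $\underline{\mathfrak g}=\Sigma\times\mathfrak{gl}(\mathbb{R}^{n+1})$. For endomorphism-valued one-forms, $[\alpha\wedge\beta]_{X,Y}=[\alpha_X,\beta_Y]-[\alpha_Y,\beta_X]$. Legendre: a filtration $0\subset E_1\subset E_2\subset\underline{\mathbb{R}}^{n+1}$ by subbundles of ranks $1$ and $n$ such that $dE_1=E_2$, i.e. $E_2$ is spanned by the values of $\sigma$ and $d_X\sigma$ for $\sigma$ a section of $E_1$ and $X$ a vector field. Put $\underline{\mathfrak g}_{-2}=\{X: XE_2=0,\ X\underline{\mathbb{R}}^{n+1}\subseteq E_1\}$, $\underline{\mathfrak g}_{-1}=\{X: XE_1=0,\ XE_2\subseteq E_1\}$, $\underline{\mathfrak g}_0=\{X: XE_1\subseteq E_1,\ XE_2\subseteq E_2\}$. A metric $g$ on $\underline{\mathbb{R}}^{n+1}$ is a non-degenerate symmetric bilinear form on the fibres (any signature). There is a unique decomposition $d=\mathcal{D}^g+\mathcal{N}^g$ with $\mathcal{D}^g$ a connection such that $\mathcal{D}^gg=0$ and $\mathcal{N}^g$ a one-form with $g$-symmetric values. $\mathfrak h\subset\underline{\mathfrak g}$ is the bundle of $g$-skew endomorphisms. $E$ envelopes $g$ if $E_1$ is $g$-null and $\mathcal{N}^g$ takes values in $\underline{\mathfrak g}_0$. $R^{\nabla}$ denotes curvature, $d^{\nabla}$ the exterior covariant derivative on endomorphism-valued forms,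 and $d\psi^g$ is the exterior derivative for the trivial connection. *)

(* Defs.v *)
From HB Require Import structures.
From mathcomp Require Import all_boot all_order all_algebra.
From mathcomp Require Import all_classical all_reals all_analysis.
From mathcomp Require Import ring.
Import Order.TTheory GRing.Theory Num.Theory numFieldNormedType.Exports.

Set Implicit Arguments.
Unset Strict Implicit.
Unset Printing Implicit Defensive.

Local Open Scope classical_set_scope.
Local Open Scope ring_scope.

#[local] Obligation Tactic := idtac.

Section EuclideanSmoothness.
Variables (R : realType) (m : nat).
Implicit Types (V : set 'rV[R]_m) (f g : 'rV[R]_m -> R).

Fixpoint Ck (k : nat) V f : Prop :=
  (forall x, V x -> {for x, continuous f}) /\
  if k is k'.+1 then
    forall i : 'I_m, (forall x, V x -> derivable f x (delta_mx ord0 i)) /\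
      Ck k' V ('D_(delta_mx ord0 i) f)
  else True.

Definition Cinfty V f : Prop := forall k, Ck k V f.

Lemma CkS k V f : Ck k.+1 V f -> Ck k V f.
Proof.
elim: k f => [|k IH] f [cf df]; split=> // i; have [dfi Cfi] := df i.
by split=> //; exact: IH.
Qed.

Lemma eq_Ck k V f g : open V -> (forall x, V x -> f x = g x) ->
  Ck k V f -> Ck k V g.
Proof.
move=> oV; have near_fg f' g' : (forall x, V x -> f' x = g' x) ->
    forall x, V x -> \near x, f' x = g' x.
  by move=> fg x Vx; apply: filterS fg _; exact: open_nbhs_nbhs.
elim: k f g => [|k IH] f g fg [cf df]; split=> //; try move=> x Vx.
1,2: rewrite /prop_for /continuous_at -(fg _ Vx).
1,2: exact: cvg_trans (near_eq_cvg (near_fg _ _ fg _ Vx)) (cf _ Vx).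
move=> i; have [dfi Cfi] := df i; split=> [x Vx|].
  exact: near_eq_derivable (near_fg _ _ fg _ Vx) (dfi _ Vx).
by apply: IH Cfi => x Vx; apply: near_eq_derive; exact: near_fg fg _ Vx.
Qed.

Lemma Ck_cst k V (a : R) : Ck k V (fun=> a).
Proof.
elim: k a => [|k IH] a; split=> //; try by move=> x _; exact: cst_continuous.
move=> i; split=> [x _|]; first exact: derivable_cst.
rewrite [X in Ck k V X](_ : _ = fun=> 0) //.
by apply/funext => x; rewrite derive_cst.
Qed.

Lemma CkD k V f g : open V -> Ck k V f -> Ck k V g -> Ck k V (f \+ g).
Proof.
move=> oV; elim: k f g => [|k IH] f g [cf df] [cg dg]; split=> //; try move=> x Vx.
1,2: exact: continuousD (cf _ Vx) (cg _ Vx).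
move=> i; have [[dfi Cfi] [dgi Cgi]] := (df i, dg i); split.
  by move=> x Vx; exact: derivableD (dfi _ Vx) (dgi _ Vx).
apply: eq_Ck (IH _ _ Cfi Cgi) => // x Vx.
exact/esym/(deriveD (dfi _ Vx) (dgi _ Vx)).
Qed.

Lemma CkM k V f g : open V -> Ck k V f -> Ck k V g -> Ck k V (f \* g).
Proof.
move=> oV; elim: k f g => [|k IH] f g Cf Cg; have [cf df] := Cf;
  have [cg dg] := Cg; split=> //; try move=> x Vx.
1,2: exact: continuousM (cf _ Vx) (cg _ Vx).
move=> i; have [[dfi Cfi] [dgi Cgi]] := (df i, dg i); split.
  by move=> x Vx; exact: derivableM (dfi _ Vx) (dgi _ Vx).
apply: eq_Ck (CkD oV (IH _ _ (CkS Cf) Cgi) (IH _ _ (CkS Cg) Cfi)) => // x Vx.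
exact/esym/(deriveM (dfi _ Vx) (dgi _ Vx)).
Qed.

End EuclideanSmoothness.

(* A chart is a homeomorphism [chart_map], with inverse [chart_inv], between
   open sets; both functions take junk values outside them. *)
Record chart (R : realType) (m : nat) (T : topologicalType) := Chart {
  chart_dom : set T;
  chart_cod : set 'rV[R]_m;
  chart_map : T -> 'rV[R]_m;
  chart_inv : 'rV[R]_m -> T;
  chart_dom_open : open chart_dom;
  chart_cod_open : open chart_cod;
  chart_mapP : forall x, chart_dom x -> chart_cod (chart_map x);
  chart_invP : forall y, chart_cod y -> chart_dom (chart_inv y);
  chart_mapK : forall x, chart_dom x -> chart_inv (chart_map x) = x;
  chart_invK : forall y, chart_cod y -> chart_map (chart_inv y) = y;
  chart_map_cont : forall x, chart_dom x -> {for x, continuous chart_map};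
  chart_inv_cont : forall y, chart_cod y -> {for y, continuous chart_inv} }.

Record manifold (R : realType) (m : nat) := Manifold {
  mcarrier :> topologicalType;
  atlas : set (chart R m mcarrier);
  manifold_hausdorff : hausdorff_space mcarrier;
  manifold_second_countable : @second_countable mcarrier;
  atlas_cover : forall x : mcarrier, exists2 c, atlas c & chart_dom c x;
  atlas_compat : forall c c', atlas c -> atlas c' -> forall j : 'I_m,
    Cinfty [set y | chart_cod c y /\ chart_dom c' (chart_inv c y)]
      (fun y => chart_map c' (chart_inv c y) ord0 j) }.

Section SmoothFunctions.
Variables (R : realType) (m : nat) (M : manifold R m).

Definition smooth_on (U : set M) (f : M -> R) : Prop :=
  forall c, atlas c ->
    Cinfty [set y | chart_cod c y /\ U (chart_inv c y)] (f \o chart_inv c).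

Definition smooth : pred (M -> R) := fun f => `[< smooth_on setT f >].

Lemma smooth_subring : subring_closed smooth.
Proof.
have oV (c : chart R m M) :
    open [set y | chart_cod c y /\ [set: M] (chart_inv c y)].
  by rewrite (_ : mkset _ = chart_cod c) ?eqEsubset;
    [exact: chart_cod_open | split=> y //= []].
split=> [|f g /asboolP Sf /asboolP Sg|f g /asboolP Sf /asboolP Sg];
  apply/asboolP => c ac k.
- exact: Ck_cst.
- apply: eq_Ck (CkD (oV c) (Sf c ac k) (CkM (oV c) (Ck_cst k _ (-1))
    (Sg c ac k))) => // x _ /=.
  by rewrite mulN1r.
- exact: CkM (Sf c ac k) (Sg c ac k).
Qed.

Definition smooth_fun := {f : M -> R | smooth f}.
HB.instance Definition _ := Choice.on smooth_fun.
HB.instance Definition _ := SubType.on smooth_fun.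
HB.instance Definition _ :=
  GRing.SubChoice_isSubComPzRing.Build _ smooth smooth_fun smooth_subring.

Lemma smooth_cst_subproof (a : R) : smooth (fun=> a).
Proof. by apply/asboolP => c _ k; exact: Ck_cst. Qed.

Definition smooth_cst (a : R) : smooth_fun :=
  exist _ (fun=> a) (smooth_cst_subproof a).

Definition ev (x : M) (p q : nat) (A : 'M[smooth_fun]_(p, q)) : 'M[R]_(p, q) :=
  map_mx (fun f => val f x) A.

End SmoothFunctions.

(* Vector fields are the derivations of the R-algebra of smooth functions. *)
Record vfield (R : realType) (m : nat) (M : manifold R m) := VField {
  vf_op :> smooth_fun M -> smooth_fun M;
  vf_linear : forall (a : R) f g,
    vf_op (smooth_cst M a * f + g) = smooth_cst M a * vf_op f + vf_op g;
  vf_leibniz : forall f g, vf_op (f * g) = f * vf_op g + g * vf_op f }.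

Section VectorFields.
Variables (R : realType) (m : nat) (M : manifold R m).
Local Notation A := (smooth_fun M).
Implicit Types X Y Z : vfield M.

HB.instance Definition _ := gen_eqMixin (vfield M).
HB.instance Definition _ := gen_choiceMixin (vfield M).

Lemma vfield_eq X Y : X =1 Y -> X = Y.
Proof.
case: X Y => [X X1 X2] [Y Y1 Y2] /= /funext XY.
by move: X1 X2; rewrite XY => X1 X2; congr VField; exact: Prop_irrelevance.
Qed.

Lemma vfieldD X f g : X (f + g) = X f + X g.
Proof.
have sc1 : smooth_cst M 1 = 1 by exact/val_inj.
by have := vf_linear X 1 f g; rewrite sc1 !mul1r.
Qed.

Lemma vfield0 X : X 0 = 0.
Proof. by apply: (addrI (X 0)); rewrite -vfieldD !addr0. Qed.

Lemma vfieldN X f : X (- f) = - X f.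
Proof. by apply/eqP; rewrite -addr_eq0 -vfieldD addNr vfield0. Qed.

Program Definition vf_zero : vfield M := @VField _ _ M (fun=> 0) _ _.
Next Obligation. by move=> a f g /=; rewrite mulr0 addr0. Qed.
Next Obligation. by move=> f g /=; rewrite !mulr0 addr0. Qed.

Program Definition vf_add X Y : vfield M :=
  @VField _ _ M (fun f => X f + Y f) _ _.
Next Obligation.
by move=> X Y a f g /=; rewrite !vf_linear mulrDr addrACA.
Qed.
Next Obligation.
by move=> X Y f g /=; rewrite !vf_leibniz !mulrDr addrACA.
Qed.

Program Definition vf_scale (h : A) X : vfield M :=
  @VField _ _ M (fun f => h * X f) _ _.
Next Obligation. by move=> h X a f g /=; rewrite vf_linear mulrDr mulrCA. Qed.
Next Obligation.
by move=> h X f g /=; rewrite vf_leibniz mulrDr !(mulrCA h).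
Qed.

Program Definition vf_bracket X Y : vfield M :=
  @VField _ _ M (fun f => X (Y f) - Y (X f)) _ _.
Next Obligation.
by move=> X Y a f g /=; rewrite !vf_linear mulrBr opprD addrACA.
Qed.
Next Obligation.
move=> X Y f g /=; rewrite !(vf_leibniz, vfieldD) !mulrBr !opprD.
by rewrite (mulrC (X g)) (mulrC (X f)); ring.
Qed.

Let vf_addA : associative vf_add.
Proof. by move=> X Y Z; apply/vfield_eq => f /=; rewrite addrA. Qed.

Let vf_addC : commutative vf_add.
Proof. by move=> X Y; apply/vfield_eq => f /=; rewrite addrC. Qed.

Let vf_add0 : left_id vf_zero vf_add.
Proof. by move=> X; apply/vfield_eq => f /=; rewrite add0r. Qed.

Let vf_addN : left_inverse vf_zero (vf_scale (-1)) vf_add.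
Proof. by move=> X; apply/vfield_eq => f /=; rewrite mulN1r addNr. Qed.

HB.instance Definition _ :=
  GRing.isZmodule.Build (vfield M) vf_addA vf_addC vf_add0 vf_addN.

Let vf_scaleA g h X : vf_scale g (vf_scale h X) = vf_scale (g * h) X.
Proof. by apply/vfield_eq => f /=; rewrite mulrA. Qed.

Let vf_scale1 : left_id 1 vf_scale.
Proof. by move=> X; apply/vfield_eq => f /=; rewrite mul1r. Qed.

Let vf_scaleDr : right_distributive vf_scale +%R.
Proof. by move=> h X Y; apply/vfield_eq => f /=; rewrite mulrDr. Qed.

Let vf_scaleDl X : {morph vf_scale^~ X : g h / g + h}.
Proof. by move=> g h; apply/vfield_eq => f /=; rewrite mulrDl. Qed.

HB.instance Definition _ := GRing.Zmodule_isLmodule.Build A (vfield M)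
  vf_scaleA vf_scale1 vf_scaleDr vf_scaleDl.

End VectorFields.

Section Bundle.
Variables (R : realType) (m : nat) (M : manifold R m) (N : nat).
Local Notation A := (smooth_fun M).

Definition oneform := {linear vfield M -> 'M[A]_N}.

(* A two-form with values in gl(R^N), through its action on sections. *)
Definition twoform := vfield M -> vfield M -> 'cV[A]_N -> 'cV[A]_N.

Record connection := Connection {
  nabla :> vfield M -> 'cV[A]_N -> 'cV[A]_N;
  nabla_linear : forall f X Y s,
    nabla (f *: X + Y) s = f *: nabla X s + nabla Y s;
  nablaD : forall X s s', nabla X (s + s') = nabla X s + nabla X s';
  nabla_leibniz : forall X f s,
    nabla X (f *: s) = X f *: s + f *: nabla X s }.

Program Definition trivial_conn : connection :=
  @Connection (fun X s => map_mx X s) _ _ _.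
Next Obligation. by move=> f X Y s; apply/matrixP => i j; rewrite !mxE. Qed.
Next Obligation.
by move=> X s s'; apply/matrixP => i j; rewrite !mxE vfieldD.
Qed.
Next Obligation.
move=> X f s; apply/matrixP => i j; rewrite !mxE vf_leibniz addrC.
by rewrite [_ * X f]mulrC.
Qed.

Program Definition conn_add (D : connection) (a : oneform) : connection :=
  @Connection (fun X s => D X s + a X *m s) _ _ _.
Next Obligation.
move=> D a f X Y s /=.
by rewrite nabla_linear linearP mulmxDl -scalemxAl scalerDr addrACA.
Qed.
Next Obligation.
by move=> D a X s s' /=; rewrite nablaD mulmxDr addrACA.
Qed.
Next Obligation.
by move=> D a X f s /=; rewrite nabla_leibniz -scalemxAr scalerDr addrA.
Qed.

(* The one-form [X |-> t X], where [t] is a real scalar. *)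
Definition oneform_scale (t : R) (a : oneform) : oneform :=
  smooth_cst M t \*: a.

Definition curvature (D : connection) : twoform := fun X Y s =>
  D X (D Y s) - D Y (D X s) - D (vf_bracket X Y) s.

Definition flat (D : connection) : Prop := forall X Y s, curvature D X Y s = 0.

(* The connection induced on endomorphisms. *)
Definition end_nabla (D : connection) X (B : 'M[A]_N) (s : 'cV[A]_N) :
    'cV[A]_N :=
  D X (B *m s) - B *m D X s.

Definition ext_deriv (D : connection) (a : oneform) : twoform := fun X Y s =>
  end_nabla D X (a Y) s - end_nabla D Y (a X) s - a (vf_bracket X Y) *m s.

Definition wedge_bracket (a b : oneform) : twoform := fun X Y s =>
  ((a X *m b Y - b Y *m a X) - (a Y *m b X - b X *m a Y)) *m s.

(* A family of subspaces of R^N is a subbundle of rank r if it has a smooth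
   frame around every point. *)
Definition subbundle (r : nat) (E : M -> {vspace 'cV[R]_N}) : Prop :=
  (forall x, \dim (E x) = r) /\
  forall x, exists U : set M, [/\ open U, U x &
    exists e : 'I_r -> M -> 'cV[R]_N,
      (forall i j, smooth_on U (fun y => e i y j ord0)) /\
      forall y, U y -> E y = span [seq e i y | i : 'I_r]].

Definition is_section (E : M -> {vspace 'cV[R]_N}) (s : 'cV[A]_N) : Prop :=
  forall x, ev x s \in E x.

(* dE = F *)
Definition derived_bundle (E F : M -> {vspace 'cV[R]_N}) : Prop :=
  forall x v, v \in F x <->
    exists l : seq 'cV[R]_N, v \in span l /\
      forall w, w \in l -> exists2 s, is_section E s &
        w = ev x s \/ exists X : vfield M, w = ev x (trivial_conn X s).

End Bundle.

(* The bilinear form with Gram matrix G. *)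
Definition form (K : pzSemiRingType) (N : nat) (G : 'M[K]_N) (u v : 'cV[K]_N) :
    K :=
  (u^T *m G *m v) ord0 ord0.

Section LegendreFiltrations.
Variables (R : realType) (m n : nat) (M : manifold R m).
Variables E1 E2 : M -> {vspace 'cV[R]_n.+1}.
Local Notation A := (smooth_fun M).

Definition legendre_filtration : Prop :=
  [/\ subbundle 1 E1, subbundle n E2, forall x, (E1 x <= E2 x)%VS &
      derived_bundle E1 E2].

Definition gm2 (x : M) (B : 'M[R]_n.+1) : Prop :=
  (forall v, v \in E2 x -> B *m v = 0) /\ (forall v, B *m v \in E1 x).

Definition gm1 (x : M) (B : 'M[R]_n.+1) : Prop :=
  (forall v, v \in E1 x -> B *m v = 0) /\
  (forall v, v \in E2 x -> B *m v \in E1 x).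

Definition g0 (x : M) (B : 'M[R]_n.+1) : Prop :=
  (forall v, v \in E1 x -> B *m v \in E1 x) /\
  (forall v, v \in E2 x -> B *m v \in E2 x).

(* A metric is given by its Gram matrix in the standard basis. *)
Definition is_metric (g : 'M[A]_n.+1) : Prop :=
  forall x,
    (forall u v, form (ev x g) u v = form (ev x g) v u) /\
    (forall u, (forall v, form (ev x g) u v = 0) -> u = 0).

Definition g_symmetric (g : 'M[A]_n.+1) (x : M) (B : 'M[R]_n.+1) : Prop :=
  forall u v, form (ev x g) (B *m u) v = form (ev x g) u (B *m v).

Definition g_skew (g : 'M[A]_n.+1) (x : M) (B : 'M[R]_n.+1) : Prop :=
  forall u v, form (ev x g) (B *m u) v = - form (ev x g) u (B *m v).

Definition takes_values (a : oneform M n.+1)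
    (P : M -> 'M[R]_n.+1 -> Prop) : Prop :=
  forall X x, P x (ev x (a X)).

Definition metric_connection (g : 'M[A]_n.+1) (D : connection M n.+1) : Prop :=
  forall (X : vfield M) s t,
    X (form g s t) = form g (D X s) t + form g s (D X t).

(* d = D + N is the decomposition determined by g. *)
Definition metric_decomposition (g : 'M[A]_n.+1) (D : connection M n.+1)
    (N : oneform M n.+1) : Prop :=
  [/\ forall X s, trivial_conn M n.+1 X s = D X s + N X *m s,
      metric_connection g D & takes_values N (g_symmetric g)].

(* [N] is the symmetric part of d with respect to [g]. *)
Definition envelopes (g : 'M[A]_n.+1) (N : oneform M n.+1) : Prop :=
  (forall x u v, u \in E1 x -> v \in E1 x -> form (ev x g) u v = 0) /\
  takes_values N g0.

End LegendreFiltrations.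

(* D + t N + (t^2 - 1) chi + (t^3 - t) psi *)
Definition pencil (R : realType) (m k : nat) (M : manifold R m)
    (D : connection M k) (N chi psi : oneform M k) (t : R) : connection M k :=
  conn_add (conn_add (conn_add D (oneform_scale t N))
    (oneform_scale (t ^+ 2 - 1) chi)) (oneform_scale (t ^+ 3 - t) psi).

(* Main.v *)
From HB Require Import structures.
Require Import Defs.
From mathcomp Require Import all_boot all_order all_algebra.
From mathcomp Require Import all_classical all_reals all_analysis.
From mathcomp Require Import ring.
Import Order.TTheory GRing.Theory Num.Theory.
Import numFieldNormedType.Exports.

(** Write d_t for the pencil and R for the curvature of D.  The theorem follows
    from the identity

      curvature of d_t
        = (t^2 - 1) (d^D chi - R) + (t^3 - t) (d psi + [N /\ chi]),

    which is [pencil_curvature]: its value at t = 0 isolates the first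
    equation, its value at t = 2 then isolates the second, and conversely the
    two equations make it vanish for every t.

    Expanding the curvature of D + t N + (t^2 - 1) chi + (t^3 - t) psi gives a
    polynomial of degree six in t, which collapses for two reasons.

    The differential reason is that d = D + N is flat.  The g-symmetric and the
    g-skew part of this equation vanish separately, which gives d^D N = 0
    ([codazzi]) and [N, N] = - R ([gauss]).

    The algebraic reason is that E_2 is the g-orthogonal complement of E_1
    ([envelope_perp]): if s is a section of the null line bundle E_1 then
    g(d_X s, s) = g(D_X s, s) + g(N_X s, s), where the first term vanishes
    because g(s, s) = 0 and D is metric, and the second because N preserves
    E_1; so E_2 = dE_1 is orthogonal to E_1, and the ranks agree.  If e spans
    E_1 at a point, the elements of g_{-2} are then the multiples of the
    symmetric operator u |-> g(e, u) e ([gm2_rank1]).  Hence N, psi and chi,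
    psi and psi, chi and chi commute: N e is a multiple of e; chi kills e and,
    being skew, has its image in E_2; and a product of two values of chi lies
    in g_{-2}, so it is symmetric, while transposition exchanges its factors.

    The derived bundle is defined by global sections, whereas E_1 only has
    local frames.  The Euclidean orthogonal projection onto E_1 provides global
    sections that generate E_1 at any prescribed point
    ([line_bundle_generator]). *)

Set Implicit Arguments.
Unset Strict Implicit.
Unset Printing Implicit Defensive.

Local Open Scope classical_set_scope.
Local Open Scope ring_scope.

Local Notation form := Defs.form.

(** * Differentiability classes *)

Section DifferentiabilityClasses.
Variables (R : realType) (m : nat).
Implicit Types (V W : set 'rV[R]_m) (f : 'rV[R]_m -> R).

(** Every clause of [Ck k V f] is a condition at the points of [V], for [f] or
    one of its iterated derivatives. *)
Lemma Ck_local k V f :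
  (forall x, V x -> exists2 W, W x & Ck k W f) -> Ck k V f.
Proof.
elim: k f => [|k IH] f Wf; split=> //; try (by move=> x Vx;
  have [W Wx [cf _]] := Wf x Vx; exact: cf).
move=> i; split=> [x Vx|]; first by have [W Wx [_ /(_ i)[df _]]] := Wf x Vx;
  exact: df.
by apply: IH => x Vx; have [W Wx [_ /(_ i)[_ Cf]]] := Wf x Vx; exists W.
Qed.

Lemma CkV k V f : open V -> (forall x, V x -> f x != 0) ->
  Ck k V f -> Ck k V (fun x => (f x)^-1).
Proof.
move=> oV f0; elim: k => [|k IH] Cf; have [cf df] := Cf; split=> //;
  try (by move=> x Vx; exact: continuousV (f0 _ Vx) (cf _ Vx)).
move=> i; have [dfi Cfi] := df i; split.
  by move=> x Vx; exact: derivableV (f0 _ Vx) (dfi _ Vx).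
have CV := IH (CkS Cf).
apply: eq_Ck (CkM oV (CkM oV (Ck_cst k V (-1)) (CkM oV CV CV)) Cfi) => // x Vx.
rewrite /= (deriveV (f0 _ Vx) (dfi _ Vx)) mulN1r -exprVn expr2.
by rewrite /GRing.scale.
Qed.

Lemma Ck_sum k V (I : Type) (r : seq I) (f : I -> 'rV[R]_m -> R) : open V ->
  (forall i, Ck k V (f i)) -> Ck k V (fun x => \sum_(i <- r) f i x).
Proof.
move=> oV Cf; elim: r => [|i r IH].
  by apply: eq_Ck (Ck_cst k V 0) => // x _; rewrite big_nil.
by apply: eq_Ck (CkD oV (Cf i) IH) => // x _; rewrite big_cons.
Qed.

End DifferentiabilityClasses.

(** * Global sections of a line bundle *)

Section LineBundles.
Variables (R : realType) (m N : nat) (M : manifold R m).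
Variable E : M -> {vspace 'cV[R]_N}.
Local Notation A := (smooth_fun M).

(** The [j]-th column of the Euclidean orthogonal projection onto the line
    spanned by [w]. *)
Definition projcol (w : 'cV[R]_N) (j : 'I_N) : 'cV[R]_N :=
  (w j ord0 / \sum_k w k ord0 ^+ 2) *: w.

Lemma sum_sqr_neq0 (w : 'cV[R]_N) : w != 0 -> \sum_k w k ord0 ^+ 2 != 0.
Proof.
apply: contraNN => /eqP /psumr_eq0P w0; apply/eqP/colP => k; rewrite mxE.
by apply/eqP; rewrite -sqrf_eq0; apply/eqP/w0 => // i _; exact: sqr_ge0.
Qed.

(** The projection depends only on the line: an arbitrary, discontinuous choice
    of generators and a smooth local frame define the same function. *)
Lemma projcolZ (c : R) (w : 'cV[R]_N) j :
  c != 0 -> projcol (c *: w) j = projcol w j.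
Proof.
move=> c0; rewrite /projcol scalerA mxE; congr (_ *: _).
under eq_bigr do rewrite mxE exprMn.
rewrite -mulr_sumr invfM expr2 invfM.
set S := \sum_k _ ^+ 2.
by rewrite [RHS](_ : _ = (c * c^-1) * (c * c^-1) * (w j ord0 / S));
  [ring | rewrite mulfV // !mul1r].
Qed.

Lemma projcol_smooth (E_line : subbundle 1 E) (i j : 'I_N) :
  smooth (fun x => projcol (vpick (E x)) j i ord0).
Proof.
apply/asboolP => c ac k; apply: Ck_local => y [cy _].
have [dimE /(_ (chart_inv c y))[U [oU Uy [e [Se spanE]]]]] := E_line.
pose W := [set z | chart_cod c z /\ U (chart_inv c z)].
have oW : open W.
  rewrite openE => z [cz Uz]; rewrite /interior; apply: filterI.
    by apply: open_nbhs_nbhs; split=> //; exact: chart_cod_open.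
  by apply: (chart_inv_cont cz); apply: open_nbhs_nbhs; split.
have lineE z : U z -> E z = <[e ord0 z]>%VS.
  move=> Uz; rewrite spanE // /image_mem enum_ordSl.
  by rewrite (size0nil (size_enum_ord 0)) span_seq1.
have e_neq0 z : U z -> e ord0 z != 0.
  by move=> Uz; have := dimE z; rewrite lineE // dim_vline; case: eqP.
(* On [W] the chosen generator is a multiple of the smooth frame [e]. *)
exists W => //.
have Ce l : Ck k W (fun z => e ord0 (chart_inv c z) l ord0) by exact: Se.
have CS : Ck k W (fun z => \sum_l e ord0 (chart_inv c z) l ord0 ^+ 2).
  by apply: (@Ck_sum R m k W _ (index_enum _)) => // l; apply: CkM.
apply: eq_Ck (CkM oW (CkM oW (Ce j) (CkV oW _ CS)) (Ce i)) => //; last first.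
  by move=> z [_ Uz]; exact: sum_sqr_neq0 (e_neq0 _ Uz).
move=> z [cz Uz] /=.
have /vlineP[a Ea] :
    vpick (E (chart_inv c z)) \in <[e ord0 (chart_inv c z)]>%VS.
  by rewrite -lineE // memv_pick.
have a0 : a != 0.
  apply/eqP => a0; move: Ea; rewrite a0 scale0r => /eqP.
  by rewrite vpick0 -dimv_eq0 dimE.
by rewrite Ea projcolZ // mxE.
Qed.

(** Columns of the Euclidean projection replace a local frame cut off by a bump
    function; some column is nonzero at [x]. *)
Lemma line_bundle_generator (E_line : subbundle 1 E) (x : M) :
  exists s : 'cV[A]_N, is_section E s /\ E x = <[ev x s]>%VS.
Proof.
have w0 y : vpick (E y) != 0 by rewrite vpick0 -dimv_eq0 E_line.1.
have [j wj] : exists j, vpick (E x) j ord0 != 0.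
  apply/existsP; have := w0 x; apply: contraNT; rewrite negb_exists.
  by move=> /forallP w; apply/eqP/colP => j; rewrite mxE; exact/eqP/negPn/w.
pose s : 'cV[A]_N :=
  \col_i (exist (@smooth R m M) _ (projcol_smooth E_line i j) : A).
have evE y : ev y s = projcol (vpick (E y)) j.
  by apply/colP => i; rewrite !mxE /= !mxE.
exists s; split=> [y|]; first by rewrite evE memvZ ?memv_pick.
rewrite evE; apply/eqP; rewrite eq_sym eqEdim E_line.1 dim_vline.
rewrite -memvE memvZ ?memv_pick //= scaler_eq0 negb_or w0 andbT.
by rewrite mulf_neq0 // invr_neq0 // sum_sqr_neq0.
Qed.

End LineBundles.

(** * Bilinear forms, commutators and evaluation at a point *)

Section BilinearForms.
Variables (K : comPzRingType) (N : nat) (G : 'M[K]_N).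
Implicit Types u v w : 'cV[K]_N.

Lemma formDl u v w : form G (u + v) w = form G u w + form G v w.
Proof. by rewrite /form linearD /= !mulmxDl mxE. Qed.

Lemma formDr u v w : form G u (v + w) = form G u v + form G u w.
Proof. by rewrite /form mulmxDr mxE. Qed.

Lemma formZl c u v : form G (c *: u) v = c * form G u v.
Proof. by rewrite /form linearZ /= -!scalemxAl mxE. Qed.

Lemma formZr c u v : form G u (c *: v) = c * form G u v.
Proof. by rewrite /form -scalemxAr mxE. Qed.

Lemma form0l v : form G 0 v = 0.
Proof. by rewrite -(scale0r 0) formZl mul0r. Qed.

Lemma formNl u v : form G (- u) v = - form G u v.
Proof. by rewrite -scaleN1r formZl mulN1r. Qed.

Lemma formNr u v : form G u (- v) = - form G u v.
Proof. by rewrite -scaleN1r formZr mulN1r. Qed.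

Lemma formBl u v w : form G (u - v) w = form G u w - form G v w.
Proof. by rewrite formDl formNl. Qed.

Lemma formBr u v w : form G u (v - w) = form G u v - form G u w.
Proof. by rewrite formDr formNr. Qed.

End BilinearForms.

Lemma mulmx_ext (K : comPzRingType) p q (B C : 'M[K]_(p, q)) :
  (forall u : 'cV_q, B *m u = C *m u) -> B = C.
Proof.
move=> BC; apply/matrixP => i j.
by have /colP/(_ i) := BC (delta_mx j ord0); rewrite -!colE !mxE.
Qed.

Definition commutator (K : pzRingType) k (B C : 'M[K]_k) := B *m C - C *m B.

Lemma commutatorZl (K : comPzRingType) k (c : K) (B C : 'M[K]_k) :
  commutator (c *: B) C = c *: commutator B C.
Proof. by rewrite /commutator scalerBr -scalemxAl -scalemxAr. Qed.

Lemma commutatorZr (K : comPzRingType) k (c : K) (B C : 'M[K]_k) :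
  commutator B (c *: C) = c *: commutator B C.
Proof. by rewrite /commutator scalerBr -scalemxAl -scalemxAr. Qed.

Section Evaluation.
Variables (R : realType) (m : nat) (M : manifold R m).
Local Notation A := (smooth_fun M).

Definition eval (x : M) (f : A) : R := val f x.

Lemma eval_zmod_morphism x : zmod_morphism (eval x).
Proof. by move=> f h. Qed.

Lemma eval_monoid_morphism x : monoid_morphism (eval x).
Proof. by split. Qed.

HB.instance Definition _ x :=
  GRing.isZmodMorphism.Build A R (eval x) (eval_zmod_morphism x).
HB.instance Definition _ x :=
  GRing.isMonoidMorphism.Build A R (eval x) (eval_monoid_morphism x).

Lemma eval_inj (f h : A) : (forall x, eval x f = eval x h) -> f = h.
Proof. by move=> fh; apply/val_inj/funext. Qed.

Lemma ev_inj p q (B C : 'M[A]_(p, q)) : (forall x, ev x B = ev x C) -> B = C.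
Proof.
move=> BC; apply/matrixP => i j; apply: eval_inj => x.
by have /matrixP/(_ i j) := BC x; rewrite !mxE.
Qed.

Lemma evM x p q r (B : 'M[A]_(p, q)) (C : 'M[A]_(q, r)) :
  ev x (B *m C) = ev x B *m ev x C.
Proof. exact: (map_mxM (eval x)). Qed.

Lemma evD x p q (B C : 'M[A]_(p, q)) : ev x (B + C) = ev x B + ev x C.
Proof. exact: (map_mxD (eval x)). Qed.

Lemma ev0 x p q : ev x (0 : 'M[A]_(p, q)) = 0.
Proof. exact: (map_mx0 (eval x)). Qed.

Lemma ev_form x N (g : 'M[A]_N) (s t : 'cV[A]_N) :
  form (ev x g) (ev x s) (ev x t) = eval x (form g s t).
Proof.
by rewrite /form (_ : (ev x s)^T = ev x s^T) ?map_trmx // -!evM mxE.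
Qed.

Definition const_section N (v : 'cV[R]_N) : 'cV[A]_N :=
  map_mx (@smooth_cst R m M) v.

Lemma ev_const_section x N (v : 'cV[R]_N) : ev x (const_section v) = v.
Proof. by apply/matrixP => i j; rewrite !mxE. Qed.

End Evaluation.

(** * Metrics and the orthogonality of E_1 and E_2 *)

Section Metrics.
Variables (R : realType) (m n : nat) (M : manifold R m).
Local Notation A := (smooth_fun M).
Variable g : 'M[A]_n.+1.
Hypothesis g_metric : is_metric g.

Lemma metric_sym s t : form g s t = form g t s.
Proof.
by apply: eval_inj => x; rewrite -!ev_form; have [sym _] := g_metric x.
Qed.

(** Nondegeneracy on sections reduces to the fibres because constant sections
    take every value. *)
Lemma metric_nondeg s : (forall t, form g s t = 0) -> s = 0.
Proof.
move=> s0; apply: ev_inj => x; rewrite ev0; have [_] := g_metric x.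
by apply=> v; rewrite -(ev_const_section x v) ev_form s0.
Qed.

Lemma form_symmetric (N : oneform M n.+1) X s t :
  takes_values N (g_symmetric g) ->
  form g (N X *m s) t = form g s (N X *m t).
Proof. by move=> sN; apply: eval_inj => x; rewrite -!ev_form !evM sN. Qed.

Lemma eq_opp_eq0 (f : A) : f = - f -> f = 0.
Proof.
move=> ff; apply: eval_inj => x; have := congr1 (eval x) ff.
by rewrite rmorphN rmorph0 => /eqP; rewrite -addr_eq0 -mulr2n mulrn_eq0 => /eqP.
Qed.

End Metrics.

Section Perp.
Variables (R : realType) (m n : nat) (M : manifold R m).
Variables E1 E2 : M -> {vspace 'cV[R]_n.+1}.
Local Notation A := (smooth_fun M).
Variables (g : 'M[A]_n.+1) (D : connection M n.+1) (N : oneform M n.+1).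
Hypothesis E_legendre : legendre_filtration E1 E2.
Hypothesis g_metric : is_metric g.
Hypothesis g_decomp : metric_decomposition g D N.
Hypothesis g_enveloped : envelopes E1 E2 g N.

(** Differentiating [g(s, t) = 0] for sections [s], [t] of E_1 only gives
    [g(D_X s, t) + g(s, D_X t) = 0].  Where [s] vanishes, the second term
    vanishes with it; where it does not, [t = s] suffices, since [s] spans the
    line. *)
Lemma derivative_perp (X : vfield M) (s : 'cV[A]_n.+1) x (e : 'cV[R]_n.+1) :
  is_section E1 s -> e \in E1 x ->
  form (ev x g) e (ev x (trivial_conn M n.+1 X s)) = 0.
Proof.
have [dDN DG _] := g_decomp; have [null N0] := g_enveloped.
have [E1_line _ _ _] := E_legendre.
have perp s1 s2 : is_section E1 s1 -> is_section E1 s2 -> form g s1 s2 = 0.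
  by move=> S1 S2; apply: eval_inj => y; rewrite -ev_form rmorph0; exact: null.
move=> Ss E1e; rewrite dDN evD evM formDr.
have -> : form (ev x g) e (ev x (N X) *m ev x s) = 0.
  by apply: (null _ _ _ E1e); apply: (N0 X x).1; exact: Ss.
rewrite addr0.
have [s0|s_neq0] := eqVneq (ev x s) 0.
  have [t [St E1t]] := line_bundle_generator E1_line x.
  move: E1e; rewrite E1t => /vlineP[a ->]; rewrite formZl ev_form.
  have := DG X s t; rewrite (perp s t) // vfield0 => /(congr1 (eval x)).
  rewrite rmorph0 rmorphD /= -[X in _ + X]ev_form s0.
  by rewrite form0l addr0 metric_sym // => <-; rewrite mulr0.
have E1s : E1 x = <[ev x s]>%VS.
  apply/eqP; rewrite eq_sym eqEdim E1_line.1 dim_vline s_neq0 andbT.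
  by rewrite -memvE; exact: Ss.
move: E1e; rewrite E1s => /vlineP[a ->]; rewrite formZl ev_form.
have -> : form g s (D X s) = 0; last by rewrite rmorph0 mulr0.
have := DG X s s; rewrite (perp s s) // vfield0 (metric_sym _ (D X s)) //.
by move=> /esym/eqP; rewrite addr_eq0 => /eqP/eq_opp_eq0.
Qed.

(** [derivative_perp] puts E_2 into the orthogonal complement of E_1, which is
    a proper subspace by nondegeneracy, hence has dimension at most [n]. *)
Lemma envelope_perp x : exists e : 'cV[R]_n.+1, [/\ e != 0, E1 x = <[e]>%VS &
  forall v, (v \in E2 x) = (form (ev x g) e v == 0)].
Proof.
have [E1_line E2_hyper _ dE] := E_legendre; have [null _] := g_enveloped.
have [s [_ E1e]] := line_bundle_generator E1_line x.
set e := ev x s in E1e; exists e.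
have e0 : e != 0 by have := E1_line.1 x; rewrite E1e dim_vline; case: eqP.
have E1_e : e \in E1 x by rewrite E1e memv_line.
split=> // v.
pose U :=
  lker (linfun (mulmx (e^T *m ev x g)) : 'Hom('cV[R]_n.+1, 'M[R]_1)).
have memU w : (w \in U) = (form (ev x g) e w == 0).
  rewrite memv_ker lfunE /= /form [in LHS](mx11_scalar (_ *m w)).
  apply/eqP/eqP => [/matrixP/(_ ord0 ord0)|->]; first by rewrite !mxE eqxx.
  by rewrite raddf0.
suff -> : E2 x = U by rewrite memU.
apply/eqP; rewrite eqEdim; apply/andP; split.
  apply/subvP => w /dE[l [lw El]]; move: lw; apply/subvP/span_subvP => {}w /El.
  move=> [t St [->|[X ->]]]; rewrite memU; apply/eqP.
    by apply: null => //; exact: St.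
  exact: derivative_perp.
rewrite E2_hyper.1 -ltnS.
have := dimvS (subvf U); rewrite leq_eqVlt (dimvf _) dim_matrix mulr1.
case/orP => // /eqP dimU.
have Uf : U = fullv.
  by apply/eqP; rewrite eqEdim subvf (dimvf _) dim_matrix mulr1 dimU /=.
case/eqP: e0; apply: (g_metric x).2 => w; apply/eqP.
by rewrite -memU Uf memvf.
Qed.

(** * Brackets in the filtered Lie algebra *)

Section Fibre.
Variable x : M.
Implicit Types B C : 'M[R]_n.+1.

(** An element of g_{-2} is determined by its value on one vector [w] outside
    E_2, because E_2 is a hyperplane, and that value is a multiple of [e]. *)
Lemma gm2_rank1 B (e : 'cV[R]_n.+1) : e != 0 -> E1 x = <[e]>%VS ->
    (forall v, (v \in E2 x) = (form (ev x g) e v == 0)) ->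
  gm2 E1 E2 x B -> exists c, forall u, B *m u = (c * form (ev x g) e u) *: e.
Proof.
move=> e0 E1e E2e [BE2 BE1].
have [w ew] : exists w, form (ev x g) e w != 0.
  apply: contrapT => /forallNP ew; case/eqP: e0; apply: (g_metric x).2 => w.
  by apply/eqP/negPn/negP/ew.
have /vlineP[b Bw] : B *m w \in <[e]>%VS by rewrite -E1e; exact: BE1.
exists (b / form (ev x g) e w) => u.
pose a := form (ev x g) e u / form (ev x g) e w.
have /BE2 : u - a *: w \in E2 x.
  by rewrite E2e formBr formZr divfK // subrr.
rewrite mulmxBr -scalemxAr Bw scalerA => /subr0_eq ->; congr (_ *: _).
by rewrite /a; ring.
Qed.

(** If [e] spans E_1 then [g(e, B u) = - g(B e, u) = 0]. *)
Lemma skew_gm1_image B u : gm1 E1 E2 x B -> g_skew g x B -> B *m u \in E2 x.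
Proof.
move=> [BE1 _] skB; have [e [_ E1e E2e]] := envelope_perp x.
have Be : B *m e = 0 by apply: BE1; rewrite E1e memv_line.
by have := skB e u; rewrite Be form0l E2e => /esym/eqP; rewrite oppr_eq0.
Qed.

Lemma gm1_gm2 B C : gm1 E1 E2 x B -> gm2 E1 E2 x C -> B *m C = 0.
Proof.
move=> [BE1 _] [_ CE1]; apply: mulmx_ext => u.
by rewrite mul0mx -mulmxA BE1.
Qed.

Lemma gm2_gm2 B C : gm2 E1 E2 x B -> gm2 E1 E2 x C -> B *m C = 0.
Proof.
have [_ _ E12 _] := E_legendre.
move=> [BE2 _] [_ CE1]; apply: mulmx_ext => u.
by rewrite mul0mx -mulmxA BE2 // (subvP (E12 x)).
Qed.

Lemma gm2_skew_gm1 B C :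
  gm2 E1 E2 x B -> gm1 E1 E2 x C -> g_skew g x C -> B *m C = 0.
Proof.
move=> [BE2 _] C1 skC; apply: mulmx_ext => u.
by rewrite mul0mx -mulmxA BE2 // skew_gm1_image.
Qed.

(** The product [B C] lies in g_{-2}, so it is symmetric; as [B] and [C] are
    skew, its transpose is [C B]. *)
Lemma skew_gm1_comm B C : gm1 E1 E2 x B -> g_skew g x B ->
  gm1 E1 E2 x C -> g_skew g x C -> B *m C = C *m B.
Proof.
move=> B1 skB C1 skC; have [e [e0 E1e E2e]] := envelope_perp x.
have [G_sym G_nondeg] := g_metric x.
have BC2 : gm2 E1 E2 x (B *m C).
  split=> v; first by move=> E2v; rewrite -mulmxA B1.1 // C1.2.
  by rewrite -mulmxA B1.2 // skew_gm1_image.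
have [c BCe] := gm2_rank1 e0 E1e E2e BC2.
apply: mulmx_ext => u; apply/subr0_eq/G_nondeg => v.
rewrite formBl -(mulmxA C) skC skB opprK mulmxA !BCe formZl formZr.
by rewrite (G_sym u); apply/eqP; rewrite subr_eq0; apply/eqP; ring.
Qed.

(** With [B e = b e] and [C u = c g(e, u) e], both products send [u] to
    [b c g(e, u) e]. *)
Lemma symmetric_g0_gm2_comm B C : g0 E1 E2 x B -> g_symmetric g x B ->
  gm2 E1 E2 x C -> B *m C = C *m B.
Proof.
move=> [BE1 _] symB C2; have [e [e0 E1e E2e]] := envelope_perp x.
have [c Ce] := gm2_rank1 e0 E1e E2e C2.
have /vlineP[b Be] : B *m e \in <[e]>%VS by rewrite -E1e BE1 // E1e memv_line.
apply: mulmx_ext => u.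
rewrite -!mulmxA !Ce -scalemxAr Be -symB Be formZl scalerA.
by congr (_ *: _); ring.
Qed.

End Fibre.

Variables chi psi : oneform M n.+1.
Hypothesis chi_values :
  takes_values chi (fun x B => gm1 E1 E2 x B /\ g_skew g x B).
Hypothesis psi_values : takes_values psi (gm2 E1 E2).

Lemma commutator_chi X Y : commutator (chi X) (chi Y) = 0.
Proof.
have [chiX chiY] := (chi_values X, chi_values Y).
rewrite /commutator [chi X *m chi Y](_ : _ = chi Y *m chi X) ?subrr //.
apply: ev_inj => x; rewrite !evM.
have [[X1 skX] [Y1 skY]] := (chiX x, chiY x).
exact: skew_gm1_comm X1 skX Y1 skY.
Qed.

Lemma commutator_psi X Y : commutator (psi X) (psi Y) = 0.
Proof.
have psi_psi Z W : psi Z *m psi W = 0.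
  apply: ev_inj => x; rewrite evM ev0.
  exact: gm2_gm2 (psi_values _ _) (psi_values _ _).
by rewrite /commutator (psi_psi X) (psi_psi Y) subrr.
Qed.

Lemma commutator_chi_psi X Y : commutator (chi X) (psi Y) = 0.
Proof.
have [chi_psi psi_chi] : chi X *m psi Y = 0 /\ psi Y *m chi X = 0.
  split; apply: ev_inj => x; rewrite evM ev0; have [X1 skX] := chi_values X x.
    exact: gm1_gm2 X1 (psi_values Y x).
  exact: gm2_skew_gm1 (psi_values Y x) X1 skX.
by rewrite /commutator chi_psi psi_chi subrr.
Qed.

Lemma commutator_N_psi X Y : commutator (N X) (psi Y) = 0.
Proof.
have [[_ _ symN] [_ N0]] := (g_decomp, g_enveloped).
rewrite /commutator [N X *m psi Y](_ : _ = psi Y *m N X) ?subrr //.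
apply: ev_inj => x; rewrite !evM.
exact: symmetric_g0_gm2_comm (N0 X x) (symN X x) (psi_values Y x).
Qed.

End Perp.

(** * Curvature of a modified connection *)

Section Curvature.
Variables (R : realType) (m k : nat) (M : manifold R m).
Local Notation A := (smooth_fun M).
Implicit Types (D : connection M k) (a b : oneform M k) (X Y : vfield M).
Implicit Types (s : 'cV[A]_k) (t : R).

Lemma curvature_trivial X Y s : curvature (trivial_conn M k) X Y s = 0.
Proof. by apply/colP => i; rewrite !mxE subrr. Qed.

Lemma curvature_conn_add D a X Y s :
  curvature (conn_add D a) X Y s =
  curvature D X Y s + ext_deriv D a X Y s + commutator (a X) (a Y) *m s.
Proof.
have regroup (K : comPzRingType) (p q r u p' q' r' u' l v : 'cV[K]_k) :
    p + q + (r + u) - (p' + q' + (r' + u')) - (l + v) =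
    p - p' - l + ((q - r') - (q' - r) - v) + (u - u').
  by apply/colP => i; rewrite !mxE; ring.
rewrite /curvature /ext_deriv /end_nabla /= !nablaD !mulmxDr regroup.
by rewrite mulmxBl (mulmxA (a X)) (mulmxA (a Y)).
Qed.

Lemma end_nabla_conn_add D a X B s :
  end_nabla (conn_add D a) X B s = end_nabla D X B s + commutator (a X) B *m s.
Proof.
have regroup (V : zmodType) (p q r u : V) : p + q - (r + u) = p - r + (q - u).
  by rewrite opprD addrACA.
rewrite /end_nabla /= mulmxDr regroup.
by rewrite [in RHS]mulmxBl (mulmxA (a X)) (mulmxA B (a X)).
Qed.

Lemma ext_deriv_conn_add D a b X Y s :
  ext_deriv (conn_add D a) b X Y s =
  ext_deriv D b X Y s + wedge_bracket a b X Y s.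
Proof.
have regroup (V : zmodType) (p q p' q' l : V) :
    p + q - (p' + q') - l = p - p' - l + (q - q').
  by rewrite [RHS]addrAC opprD (addrACA p q).
rewrite /ext_deriv.
rewrite (end_nabla_conn_add D a X) (end_nabla_conn_add D a Y) regroup.
congr (_ + _); exact/esym/mulmxBl.
Qed.

Lemma vfield_cst X t : X (smooth_cst M t) = 0.
Proof.
have X1 : X 1 = 0.
  have := vf_leibniz X 1 1; rewrite !mul1r => /esym/eqP.
  by rewrite -subr_eq0 addrK => /eqP.
by have := vf_linear X t 1 0; rewrite mulr1 addr0 X1 vfield0 mulr0 addr0.
Qed.

Lemma nabla_cst D X t s :
  D X (smooth_cst M t *: s) = smooth_cst M t *: D X s.
Proof. by rewrite nabla_leibniz vfield_cst scale0r add0r. Qed.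

Lemma oneform_scaleE t a X : oneform_scale t a X = smooth_cst M t *: a X.
Proof. by []. Qed.

Lemma ext_deriv_scale D t a X Y s :
  ext_deriv D (oneform_scale t a) X Y s = smooth_cst M t *: ext_deriv D a X Y s.
Proof.
have scaleE Z u : oneform_scale t a Z *m u = smooth_cst M t *: (a Z *m u).
  by rewrite oneform_scaleE scalemxAl.
have regroup (K : pzRingType) (V : lmodType K) c (p q p' q' l : V) :
    c *: p - c *: q - (c *: p' - c *: q') - c *: l =
    c *: (p - q - (p' - q') - l).
  by rewrite !scalerBr.
by rewrite /ext_deriv /end_nabla !scaleE !nabla_cst regroup.
Qed.

Lemma wedge_bracketE a b X Y s :
  wedge_bracket a b X Y s =
  (commutator (a X) (b Y) - commutator (a Y) (b X)) *m s.
Proof. by []. Qed.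

Lemma wedge_bracket_eq0 a b X Y s :
  (forall Z W, commutator (a Z) (b W) = 0) -> wedge_bracket a b X Y s = 0.
Proof. by move=> ab0; rewrite wedge_bracketE !ab0 subrr mul0mx. Qed.

Lemma curvature_add_scale D t a X Y s :
  curvature (conn_add D (oneform_scale t a)) X Y s =
  curvature D X Y s + smooth_cst M t *: ext_deriv D a X Y s
    + smooth_cst M t ^+ 2 *: (commutator (a X) (a Y) *m s).
Proof.
rewrite curvature_conn_add ext_deriv_scale; congr (_ + _).
rewrite (oneform_scaleE t a X) (oneform_scaleE t a Y).
by rewrite commutatorZl commutatorZr scalerA -expr2 -scalemxAl.
Qed.

Lemma ext_deriv_add_scale D t a b X Y s :
  ext_deriv (conn_add D (oneform_scale t a)) b X Y s =
  ext_deriv D b X Y s + smooth_cst M t *: wedge_bracket a b X Y s.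
Proof.
rewrite ext_deriv_conn_add; congr (_ + _); rewrite [LHS]wedge_bracketE.
rewrite (oneform_scaleE t a X) (oneform_scaleE t a Y).
by rewrite (commutatorZl _ (a X)) (commutatorZl _ (a Y)) -scalerBr -scalemxAl.
Qed.

End Curvature.

(** * Symmetric and skew parts of the flatness of d *)

Section Decomposition.
Variables (R : realType) (m n : nat) (M : manifold R m).
Local Notation A := (smooth_fun M).
Variables (g : 'M[A]_n.+1) (D : connection M n.+1) (N : oneform M n.+1).
Hypothesis g_metric : is_metric g.
Hypothesis g_decomp : metric_decomposition g D N.

Lemma curvature_skew X Y s t :
  form g (curvature D X Y s) t = - form g s (curvature D X Y t).
Proof.
have regroup (K : comPzRingType) (z z' p p' q q' b c : K) :
    z + z' = p + b + (c + q) - (p' + c + (b + q')) ->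
    p - p' - z = - (q - q' - z').
  by move=> /(canRL (addrK z')) ->; ring.
have [_ DG _] := g_decomp.
have XY : vf_bracket X Y (form g s t) =
    X (Y (form g s t)) - Y (X (form g s t)) by [].
move: XY; rewrite !DG !vfieldD !DG /curvature !formBl !formBr.
exact: regroup.
Qed.

Lemma ext_deriv_symmetric X Y s t :
  form g (ext_deriv D N X Y s) t = form g s (ext_deriv D N X Y t).
Proof.
have regroup (K : comPzRingType) (p q r u : K) :
    p + q = r + u -> p - r = u - q.
  by move=> /(canRL (addrK q)) ->; ring.
have [_ DG symN] := g_decomp.
have sN Z u v := form_symmetric Z u v symN.
have DN Z W u v : form g (end_nabla D Z (N W) u) v =
    form g u (end_nabla D Z (N W) v).
  rewrite /end_nabla formBl formBr (sN W (D Z u)) -(sN W u (D Z v)).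
  by apply: regroup; rewrite -!DG sN.
have formB3l (G : 'M[A]_n.+1) u v w z :
    form G (u - v - w) z = form G u z - form G v z - form G w z.
  by rewrite (formBl G (u - v)) (formBl G u).
have formB3r (G : 'M[A]_n.+1) u v w z :
    form G z (u - v - w) = form G z u - form G z v - form G z w.
  by rewrite (formBr G z (u - v)) (formBr G z u).
by rewrite /ext_deriv formB3l formB3r (DN X Y) (DN Y X) sN.
Qed.

Lemma commutator_skew X Y s t :
  form g (commutator (N X) (N Y) *m s) t =
  - form g s (commutator (N X) (N Y) *m t).
Proof.
have [_ _ symN] := g_decomp.
have sN Z u v := form_symmetric Z u v symN.
rewrite !mulmxBl formBl formBr -!(mulmxA (N X)) -!(mulmxA (N Y)).
by rewrite !sN opprB.
Qed.

Lemma curvature_decomposition X Y s :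
  curvature D X Y s + ext_deriv D N X Y s + commutator (N X) (N Y) *m s = 0.
Proof.
have [dDN _ _] := g_decomp.
rewrite -curvature_conn_add -[RHS](curvature_trivial X Y s).
by rewrite /curvature !dDN.
Qed.

(** By [curvature_decomposition] the symmetric two-form d^D N is also skew. *)
Lemma codazzi X Y s : ext_deriv D N X Y s = 0.
Proof.
have dN u : ext_deriv D N X Y u =
    - (curvature D X Y u + commutator (N X) (N Y) *m u).
  by apply/eqP; rewrite -addr_eq0 addrCA addrA curvature_decomposition.
apply: (metric_nondeg g_metric) => t; apply: eq_opp_eq0.
rewrite {1}ext_deriv_symmetric !dN formNr formNl formDl formDr.
by rewrite curvature_skew commutator_skew !opprD !opprK.
Qed.

Lemma gauss X Y s :
  commutator (N X) (N Y) *m s = - curvature D X Y s.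
Proof.
apply/eqP; rewrite -addr_eq0 addrC.
by have := curvature_decomposition X Y s; rewrite codazzi addr0 => ->.
Qed.

End Decomposition.

(** * Curvature of the pencil *)

Section Pencil.
Variables (R : realType) (m n : nat) (M : manifold R m).
Variables E1 E2 : M -> {vspace 'cV[R]_n.+1}.
Local Notation A := (smooth_fun M).
Variables (g : 'M[A]_n.+1) (D : connection M n.+1) (N chi psi : oneform M n.+1).
Hypothesis E_legendre : legendre_filtration E1 E2.
Hypothesis g_metric : is_metric g.
Hypothesis g_decomp : metric_decomposition g D N.
Hypothesis g_enveloped : envelopes E1 E2 g N.
Hypothesis chi_values :
  takes_values chi (fun x B => gm1 E1 E2 x B /\ g_skew g x B).
Hypothesis psi_values : takes_values psi (gm2 E1 E2).

Let N_psi := commutator_N_psi E_legendre g_metric g_decomp g_enveloped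
  psi_values.
Let chi_psi := commutator_chi_psi E_legendre g_metric g_decomp g_enveloped
  chi_values psi_values.
Let chi_chi := commutator_chi E_legendre g_metric g_decomp g_enveloped
  chi_values.
Let psi_psi := commutator_psi E_legendre psi_values.

(** The difference is [N /\ psi], and [N] commutes with [psi]. *)
Lemma ext_deriv_psi X Y s :
  ext_deriv (trivial_conn M n.+1) psi X Y s = ext_deriv D psi X Y s.
Proof.
have [dDN _ _] := g_decomp.
have -> : ext_deriv (trivial_conn M n.+1) psi X Y s =
    ext_deriv (conn_add D N) psi X Y s by rewrite /ext_deriv /end_nabla !dDN.
rewrite ext_deriv_conn_add (wedge_bracket_eq0 _ _ _ N_psi).
exact: addr0.
Qed.

Lemma pencil_curvature t X Y s :
  curvature (pencil D N chi psi t) X Y s =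
  smooth_cst M (t ^+ 2 - 1) *: (ext_deriv D chi X Y s - curvature D X Y s) +
  smooth_cst M (t ^+ 3 - t) *:
    (ext_deriv (trivial_conn M n.+1) psi X Y s + wedge_bracket N chi X Y s).
Proof.
(* Here [c = t], [a = t^2 - 1], [b = t^3 - t = t a], and the zeros stand for
   d^D N and for the brackets that vanish. *)
have regroup (K : comPzRingType) (V : lmodType K) (c a b : K) (r dc dp w : V) :
    a = c ^+ 2 - 1 -> b = c * a ->
    r + c *: 0 + c ^+ 2 *: (- r) + a *: (dc + c *: w) + a ^+ 2 *: 0
      + b *: (dp + c *: 0 + a *: 0) + b ^+ 2 *: 0 =
    a *: (dc - r) + b *: (dp + w).
  move=> aE bE; rewrite !scaler0 !addr0 scalerN.
  have -> : r - c ^+ 2 *: r = - (a *: r) by rewrite aE scalerBl scale1r opprB.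
  rewrite !scalerDr scalerN scalerA -(mulrC c) -bE.
  by rewrite addrA (addrC (- _)) -!addrA (addrC (b *: w)).
rewrite /pencil !curvature_add_scale !ext_deriv_add_scale.
rewrite (codazzi g_metric g_decomp X Y s) (gauss g_metric g_decomp X Y s).
rewrite (wedge_bracket_eq0 _ _ _ N_psi) (wedge_bracket_eq0 _ _ _ chi_psi).
rewrite chi_chi psi_psi mul0mx ext_deriv_psi.
apply: regroup; apply/val_inj/funext => x /=.
  by rewrite expr2.
by transitivity (t * (t ^+ 2 - 1)); first ring.
Qed.

End Pencil.

Lemma smooth_cst_scale_eq0 (R : realType) (m k : nat) (M : manifold R m) (a : R)
    (v : 'cV[smooth_fun M]_k) :
  a != 0 -> smooth_cst M a *: v = 0 -> v = 0.
Proof.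
move=> a0 av; rewrite -[v]scale1r.
have <- : smooth_cst M a^-1 * smooth_cst M a = 1.
  by apply/val_inj/funext => x /=; exact: mulVf.
by rewrite -scalerA av scaler0.
Qed.

Theorem mainTheorem4 (R : realType) (m n : nat) (m_ge2 : (2 <= m)%N)
    (n_def : n = m.+1) (Sigma : manifold R m)
    (E1 E2 : Sigma -> {vspace 'cV[R]_n.+1})
    (E_legendre : legendre_filtration E1 E2)
    (g : 'M[smooth_fun Sigma]_n.+1) (g_metric : is_metric g)
    (D : connection Sigma n.+1) (N : oneform Sigma n.+1)
    (g_decomp : metric_decomposition g D N)
    (g_enveloped : envelopes E1 E2 g N)
    (chi psi : oneform Sigma n.+1)
    (chi_values : takes_values chi (fun x B => gm1 E1 E2 x B /\ g_skew g x B))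
    (psi_values : takes_values psi (gm2 E1 E2)) :
  (forall t : R, flat (pencil D N chi psi t)) <->
  ((forall X Y s, ext_deriv D chi X Y s = curvature D X Y s) /\
   (forall X Y s,
      ext_deriv (trivial_conn Sigma n.+1) psi X Y s
        + wedge_bracket N chi X Y s = 0)).
Proof.
(* The coefficients are -1 and 0 at t = 0, and 3 and 6 at t = 2. *)
have curvE := pencil_curvature E_legendre g_metric g_decomp g_enveloped
  chi_values psi_values.
split=> [flat_t | [chiE psiE] t X Y s]; last first.
  by rewrite curvE chiE psiE subrr !scaler0 addr0.
have chiE X Y s : ext_deriv D chi X Y s = curvature D X Y s.
  apply/subr0_eq/(@smooth_cst_scale_eq0 _ _ _ _ (0 ^+ 2 - 1)).
    by rewrite expr0n sub0r oppr_eq0 oner_eq0.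
  have := flat_t 0 X Y s; rewrite curvE.
  have -> : smooth_cst Sigma (0 ^+ 3 - 0) = 0.
    by apply/val_inj/funext => x /=; rewrite subr0 expr0n.
  by rewrite scale0r addr0.
split=> // X Y s; apply: (@smooth_cst_scale_eq0 _ _ _ _ (2 ^+ 3 - 2)).
  rewrite (_ : 2 ^+ 3 - 2 = 6%:R); last by ring.
  by rewrite pnatr_eq0.
by have := flat_t 2 X Y s; rewrite curvE chiE subrr scaler0 add0r.
Qed.
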